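(* Let $\Gamma$ be a group. The following are equivalent: (1) $\Gamma$ is sofic. (2) There is an injective homomorphism $\Gamma\to\mathfrak S(\tau/\omega)$ for an index set $I$ of cardinality at most $|\Gamma|$, and an appropriate choice of $\tau,\omega$ (that is, an ultrafilter $\omega$ on $I$ and a function $\tau:I\to\mathbb N$ with $\lim_\omega\tau=\infty$). In particular, the groups $\mathfrak S(\tau/\omega)$ are themselves sofic for all $I,\tau,\omega$ (where $I$ is a set, $\omega$ is an ultrafilter on $I$, and $\tau:I\to\mathbb N$ satisfies $\lim_\omega\tau=\infty$).
   Context: For a natural number $d\ge 1$, $S_d$ is the symmetric group on $\{1,\dots,d\}$, and for $\alpha\in S_d$, $\#_{\rm fix}\alpha$ denotes the number of fixed points of $\alpha$. Sofic group: a group $\Gamma$ is sofic if for any real number $0<\varepsilon<1$ and any finite subset $F\subseteq\Gamma$ there exist a natural number $n\ge 1$ and a function $\phi:\Gamma\to S_n$ such that (a) $\#_{\rm fix}(\phi(e)\phi(f)\phi(ef)^{-1})\ge(1-\varepsilon)n$ for any two elements $e,f\in F$; (b) $\phi(1)=1$; (c) $\#_{\rm fix}\phi(e)\le\varepsilon n$ for any $1\ne e\in F$. The group $\mathfrak S(\tau/\omega)$: let $\omega$ be an ultrafilter on a set $I$ and $\tau:I\to\mathbb N$ a function with $\lim_\omega\tau=\infty$, where $\lim_\omega$ denotes the ultralimit. Put $\mathfrak S(\tau)=\prod_{i\in I}S_{\tau(i)}$; for $\pi\in\mathfrak S(\tau)$ let $\pi(i)\in S_{\tau(i)}$ be its $i$-th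 component and put $\#_{\rm fix}\pi=\lim_\omega \frac{\#_{\rm fix}\pi(i)}{\tau(i)}$. The set $\{\pi\in\mathfrak S(\tau) : \#_{\rm fix}\pi=1\}$ is a normal subgroup of $\mathfrak S(\tau)$, and $\mathfrak S(\tau/\omega)=\mathfrak S(\tau)/\{\pi\in\mathfrak S(\tau) : \#_{\rm fix}\pi=1\}$.
   Formalization: For finite Γ, ''I of cardinality at most |Γ|'' is replaced by ''I countable'' (so |I| ≤ max(|Γ|, ℵ₀)), since on a finite set every ultrafilter is principal and lim_ω τ = ∞ is impossible, although finite groups are sofic. *)

(* Defs.v *)
From HB Require Import structures.
From mathcomp Require Import all_boot all_order all_algebra all_fingroup.
From mathcomp Require Import generic_quotient.
From mathcomp Require Import all_classical all_reals all_analysis.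

Set Implicit Arguments.
Unset Strict Implicit.
Unset Printing Implicit Defensive.

Import Order.TTheory GRing.Theory Num.Theory.
Import numFieldNormedType.Exports.

Local Open Scope classical_set_scope.
Local Open Scope ring_scope.

Section GroupQuotient.
Local Open Scope quotient_scope.
Local Open Scope group_scope.

Record normal_subgroup (G : groupType) := NormalSubgroup {
  normal_pred :> {pred G};
  normal1 : 1 \in normal_pred;
  normalM : {in normal_pred &, forall x y, x * y \in normal_pred};
  normalV : {in normal_pred, forall x, x^-1 \in normal_pred};
  normalJ : forall x y : G, x \in normal_pred -> x ^ y \in normal_pred }.

Variables (G : groupType) (N : normal_subgroup G).

Definition coset_rel (x y : G) : bool := x^-1 * y \in N.

Lemma coset_rel_refl : reflexive coset_rel.
Proof. by move=> x; rewrite /coset_rel mulVg normal1. Qed.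

Lemma coset_rel_sym : symmetric coset_rel.
Proof.
move=> x y; apply/idP/idP; rewrite /coset_rel => /normalV.
  by rewrite invgM invgK.
by rewrite invgM invgK.
Qed.

Lemma coset_rel_trans : transitive coset_rel.
Proof.
move=> y x z xy yz; rewrite /coset_rel.
have -> : x^-1 * z = (x^-1 * y) * (y^-1 * z) by rewrite mulgA mulgK.
exact: normalM.
Qed.

Canonical coset_equiv :=
  EquivRel coset_rel coset_rel_refl coset_rel_sym coset_rel_trans.

Definition group_quot : Type := {eq_quot coset_equiv}.

HB.instance Definition _ := Choice.on group_quot.
HB.instance Definition _ := EqQuotient.on group_quot.

Lemma coset_eqP (x y : G) : reflect (\pi_group_quot x = \pi_group_quot y)%qT (coset_rel x y).
Proof. by apply: (iffP idP) => [h|/eqmodP //]; apply/eqmodP. Qed.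

Definition quot_one : group_quot := \pi_group_quot%qT 1.
Definition quot_mul (a b : group_quot) : group_quot :=
  \pi_group_quot%qT (repr a * repr b).
Definition quot_inv (a : group_quot) : group_quot := \pi_group_quot%qT (repr a)^-1.

Lemma quot_mulE (x y : G) :
  quot_mul (\pi_group_quot%qT x) (\pi_group_quot%qT y) = \pi_group_quot%qT (x * y).
Proof.
apply/coset_eqP; rewrite /coset_rel.
have /coset_eqP hx : (\pi_group_quot (repr (\pi_group_quot x)) = \pi_group_quot x)%qT.
  by rewrite reprK.
have /coset_eqP hy : (\pi_group_quot (repr (\pi_group_quot y)) = \pi_group_quot y)%qT.
  by rewrite reprK.
move: (repr (\pi_group_quot x)) (repr (\pi_group_quot y)) hx hy => x' y'.
rewrite /coset_rel => hx hy.
have -> : (x' * y')^-1 * (x * y) = (x'^-1 * x) ^ y' * (y'^-1 * y).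
  by rewrite conjgE invgM !mulgA mulgK.
by apply: normalM => //; apply: normalJ.
Qed.

Lemma quot_invE (x : G) :
  quot_inv (\pi_group_quot%qT x) = \pi_group_quot%qT x^-1.
Proof.
apply/coset_eqP; rewrite /coset_rel.
have /coset_eqP hx : (\pi_group_quot (repr (\pi_group_quot x)) = \pi_group_quot x)%qT.
  by rewrite reprK.
move: (repr _) hx => x' hx; rewrite invgK.
have -> : x' * x^-1 = ((x'^-1 * x)^-1) ^ x'^-1.
  by rewrite conjgE invgM !invgK !mulgA mulgK.
by apply: normalJ; apply: normalV.
Qed.

Lemma quot_ind (P : group_quot -> Prop) :
  (forall x, P (\pi_group_quot%qT x)) -> forall a, P a.
Proof. by move=> h a; rewrite -[a]reprK. Qed.

Lemma quot_mulA : associative quot_mul.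
Proof.
elim/quot_ind=> x; elim/quot_ind=> y; elim/quot_ind=> z.
by rewrite !quot_mulE mulgA.
Qed.

Lemma quot_mul1 : left_id quot_one quot_mul.
Proof. by elim/quot_ind=> x; rewrite quot_mulE mul1g. Qed.

Lemma quot_mulr1 : right_id quot_one quot_mul.
Proof. by elim/quot_ind=> x; rewrite quot_mulE mulg1. Qed.

Lemma quot_mulV : left_inverse quot_one quot_inv quot_mul.
Proof. by elim/quot_ind=> x; rewrite quot_invE quot_mulE mulVg. Qed.

Lemma quot_mulrV : right_inverse quot_one quot_inv quot_mul.
Proof. by elim/quot_ind=> x; rewrite quot_invE quot_mulE mulgV. Qed.

HB.instance Definition _ := isGroup.Build group_quot
  quot_mulA quot_mul1 quot_mulr1 quot_mulV quot_mulrV.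

End GroupQuotient.

Section SymProduct.
Local Open Scope group_scope.
Variables (I : Type) (tau : I -> nat).

Definition sym_prod : Type := forall i : I, 'S_(tau i).

HB.instance Definition _ := Choice.on sym_prod.

Definition sym_prod_one : sym_prod := fun i => 1.
Definition sym_prod_mul (p q : sym_prod) : sym_prod := fun i => p i * q i.
Definition sym_prod_inv (p : sym_prod) : sym_prod := fun i => (p i)^-1.

Lemma sym_prod_mulA : associative sym_prod_mul.
Proof. by move=> p q r; apply: functional_extensionality_dep => i; exact: mulgA. Qed.
Lemma sym_prod_mul1 : left_id sym_prod_one sym_prod_mul.
Proof. by move=> p; apply: functional_extensionality_dep => i; exact: mul1g. Qed.
Lemma sym_prod_mulr1 : right_id sym_prod_one sym_prod_mul.
Proof. by move=> p; apply: functional_extensionality_dep => i; exact: mulg1. Qed.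
Lemma sym_prod_mulV : left_inverse sym_prod_one sym_prod_inv sym_prod_mul.
Proof. by move=> p; apply: functional_extensionality_dep => i; exact: mulVg. Qed.
Lemma sym_prod_mulrV : right_inverse sym_prod_one sym_prod_inv sym_prod_mul.
Proof. by move=> p; apply: functional_extensionality_dep => i; exact: mulgV. Qed.

HB.instance Definition _ := isGroup.Build sym_prod
  sym_prod_mulA sym_prod_mul1 sym_prod_mulr1 sym_prod_mulV sym_prod_mulrV.

End SymProduct.

Definition nfix (d : nat) (s : 'S_d) : nat := #|[pred x | s x == x]|.

Section NfixTheory.
Local Open Scope group_scope.
Variable d : nat.
Implicit Types s t : 'S_d.

Lemma nfix1 : nfix (1 : 'S_d) = d.
Proof.
rewrite /nfix -[RHS]card_ord; apply: eq_card => x.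
by rewrite !inE perm1 eqxx.
Qed.

Lemma nfix_le s : (nfix s <= d)%N.
Proof. by rewrite -[X in (_ <= X)%N]card_ord /nfix; exact: max_card. Qed.

Lemma nfixV s : nfix s^-1 = nfix s.
Proof.
apply: eq_card => x; rewrite !inE; apply/eqP/eqP => h.
  by rewrite -{1}h permKV.
by rewrite -{1}h permK.
Qed.

Lemma nfixJ s t : nfix (s ^ t) = nfix s.
Proof.
rewrite /nfix -[RHS](fintype.card_image (@perm.perm_inj _ t)); apply: eq_card => x.
rewrite inE; apply/eqP/fintype.imageP => [h|[y + ->]].
  exists (t^-1 x); last by rewrite permKV.
  by rewrite inE -(inj_eq (@perm.perm_inj _ t)) -{2}h conjgE !permM permKV.
by rewrite inE => /eqP h; rewrite permJ h.
Qed.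

Lemma nfixM s t : (nfix s + nfix t <= nfix (s * t)%g + d)%N.
Proof.
rewrite /nfix -cardUI addnC leq_add //.
  apply/subset_leq_card/fintype.subsetP => x; rewrite !inE => /andP[/eqP sx /eqP tx].
  by rewrite permM sx tx.
by rewrite -[X in (_ <= X)%N]card_ord; exact: max_card.
Qed.

End NfixTheory.

(* The group law of 'S_n is written left to right, (s * t) x = t (s x); since
   s |-> s^-1 reverses products and preserves the number of fixed points, the
   notion does not depend on this convention. *)
Definition sofic (R : realType) (G : groupType) : Prop :=
  forall (eps : R) (F : set G), 0 < eps < 1 -> finite_set F ->
  exists (n : nat) (phi : G -> 'S_n),
    [/\ (1 <= n)%N,
        forall e f, F e -> F f ->
          (1 - eps) * n%:R <= (nfix (phi e * phi f * (phi (e * f)%g)^-1)%g)%:R,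
        phi 1%g = 1%g
      & forall e, F e -> e <> 1%g -> (nfix (phi e))%:R <= eps * n%:R].

Section Ultraproduct.
Variables (R : realType) (I : Type) (omega : set_system I).
Variables (Uomega : UltraFilter omega) (tau : I -> nat).
Hypothesis tau_oo : tau @ omega --> \oo.
Implicit Types p q : sym_prod tau.

(* When tau i = 0 the ratio is 0; by tau_oo this only concerns indices outside
   some set of omega, so it never affects the limit. *)
Definition fix_ratio p (i : I) : R := (nfix (p i))%:R / (tau i)%:R.

Definition fixlim p : R := lim (fix_ratio p @ omega).

Lemma fix_ratio_ge0 p i : 0 <= fix_ratio p i.
Proof. by rewrite divr_ge0. Qed.

Lemma fix_ratio_le1 p i : fix_ratio p i <= 1.
Proof.
rewrite /fix_ratio; have [t0|t0] := eqVneq ((tau i)%:R : R) 0.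
  by rewrite t0 invr0 mulr0.
move: t0; rewrite pnatr_eq0 => t0.
by rewrite ler_pdivrMr ?ltr0n ?lt0n// mul1r ler_nat nfix_le.
Qed.

Lemma is_cvg_fix_ratio p : cvg (fix_ratio p @ omega).
Proof.
have [x [_ clx]] : `[0, 1]%classic `&` cluster (fix_ratio p @ omega) !=set0.
  apply: (@segment_compact R 0 1).
  apply: (@filterE _ omega) => i; rewrite /= in_itv /=.
  by rewrite fix_ratio_ge0 fix_ratio_le1.
apply/cvg_ex; exists x => A Ax.
have [//|nA] := in_ultra_setVsetC (fix_ratio p @^-1` A) Uomega.
by have [y [/= + Ay]] := clx (~` A) A nA Ax.
Qed.

Lemma tau_gt0 : \forall i \near omega, (0 < tau i)%N.
Proof. exact: (tau_oo (nbhs_infty_gt 0)). Qed.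

Lemma fixlimP p : fix_ratio p @ omega --> fixlim p.
Proof. exact: is_cvg_fix_ratio. Qed.

Lemma fixlim_eq p q : fix_ratio p =1 fix_ratio q -> fixlim p = fixlim q.
Proof. by move=> /funext h; rewrite /fixlim h. Qed.

Lemma fixlim_one : fixlim 1%g = 1.
Proof.
apply: cvg_lim => //; apply: cvg_near_cst.
near=> i; apply/eqP; rewrite /fix_ratio nfix1 divff // pnatr_eq0 -lt0n.
by near: i; exact: tau_gt0.
Unshelve. all: by end_near. Qed.

Lemma fixlim_inv p : fixlim (p^-1)%g = fixlim p.
Proof. by apply: fixlim_eq => i; rewrite /fix_ratio nfixV. Qed.

Lemma fixlim_conj p q : fixlim (p ^ q)%g = fixlim p.
Proof.
apply: fixlim_eq => i; rewrite /fix_ratio.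
by have -> : (p ^ q)%g i = (p i ^ q i)%g by []; rewrite nfixJ.
Qed.

Lemma fixlim_mul p q : fixlim p = 1 -> fixlim q = 1 -> fixlim (p * q)%g = 1.
Proof.
move=> p1 q1; apply: cvg_lim => //.
apply: (@squeeze_cvgr _ _ _ _ (fun i => fix_ratio p i + fix_ratio q i - 1) (cst 1)).
- near=> i; rewrite fix_ratio_le1 andbT /fix_ratio.
  have t0 : 0 < (tau i)%:R :> R by rewrite ltr0n; near: i; exact: tau_gt0.
  have := nfixM (p i) (q i); rewrite lerBlDr -(ler_nat R) !natrD.
  by rewrite -(@ler_pM2r _ (tau i)%:R^-1) ?invr_gt0// !mulrDl divff ?gt_eqF.
- rewrite -[X in _ --> X](addrK (1 : R)).
  apply: (@cvgB _ _ _ omega); last exact: cvg_cst.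
  by apply: (@cvgD _ _ _ omega); [rewrite -p1|rewrite -q1]; exact: fixlimP.
- exact: cvg_cst.
Unshelve. all: by end_near. Qed.

Definition fix1_pred : {pred sym_prod tau} := [pred p | fixlim p == 1].

Fact fix1_pred1 : 1%g \in fix1_pred.
Proof. by rewrite inE fixlim_one. Qed.
Fact fix1_predM : {in fix1_pred &, forall p q, (p * q)%g \in fix1_pred}.
Proof. by move=> p q; rewrite !inE => /eqP p1 /eqP q1; rewrite fixlim_mul. Qed.
Fact fix1_predV : {in fix1_pred, forall p, (p^-1)%g \in fix1_pred}.
Proof. by move=> p; rewrite !inE fixlim_inv. Qed.
Fact fix1_predJ p q : p \in fix1_pred -> (p ^ q)%g \in fix1_pred.
Proof. by rewrite !inE fixlim_conj. Qed.

Definition fix1_subgroup : normal_subgroup (sym_prod tau) :=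
  NormalSubgroup fix1_pred1 fix1_predM fix1_predV fix1_predJ.

Definition sym_ultraprod : groupType := group_quot fix1_subgroup.

End Ultraproduct.

(* |I| <= |G| when G is infinite.  A finite set carries no ultrafilter along
   which a nat-valued function tends to infinity, so for finite G the bound is
   aleph_0; in both cases this says |I| <= max(|G|, aleph_0). *)
Definition index_card_le (I G : Type) : Prop :=
  ([set: I] #<= [set: G])%card \/ (finite_set [set: G] /\ countable [set: I]).

(* Main.v *)
(* An ultraproduct of symmetric groups is sofic: for a finite set F of its
   elements, the components at a suitable index of lifts of the elements of F are
   almost multiplicative, and the lift of a nontrivial element has a ratio of
   fixed points bounded away from 1; letting these permutations act diagonally on
   k-tuples raises all ratios to the power k, which makes the latter small and
   keeps those close to 1 close to 1.  Subgroups of sofic groups are sofic.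
   Conversely, index almost homomorphisms of a sofic group G by the pairs of a
   finite list in G and an accuracy n, and take an ultrafilter containing all
   upward cones of this directed set; for infinite G this index set has the
   cardinality of G because G x G injects into G. *)

From HB Require Import structures.
Require Import Defs.
From mathcomp Require Import all_boot all_order all_algebra all_fingroup.
From mathcomp Require Import all_classical all_reals all_analysis.
From mathcomp Require Import generic_quotient lra.

Set Implicit Arguments.
Unset Strict Implicit.
Unset Printing Implicit Defensive.

Import Order.TTheory GRing.Theory Num.Theory.
Import numFieldNormedType.Exports.

Local Open Scope classical_set_scope.
Local Open Scope ring_scope.


(** * Comparability of cardinals and squares of infinite sets *)

(** Zorn's lemma gives a maximal graph [S] of a partial bijection between [A] and [B]. If it missed
    both some [a] in [A] and some [b] in [B], adding the pair [(a, b)] would enlarge it. *)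
Lemma card_le_total (T U : pointedType) (A : set T) (B : set U) :
  (A #<= B)%card \/ (B #<= A)%card.
Proof.
pose P (S : set (T * U)) := S `<=` A `*` B /\
  forall z w, S z -> S w -> (z.1 = w.1 <-> z.2 = w.2).
have [|S [[SAB Sinj] Smax]] := @Zorn_bigcup _ P.
  move=> F FP Ftot; split=> [z [S FS Sz]|z w [S FS Sz] [S' FS' S'w]].
    by apply: (FP _ FS).1.
  by have [SS'|S'S] := Ftot _ _ FS FS';
    [apply: (FP _ FS').2 => //; exact: SS'|apply: (FP _ FS).2 => //; exact: S'S].
have [Adom|/existsNP[a /not_implyP[Aa /forallNP Sa]]] :=
    pselect (forall a, A a -> exists b, S (a, b)).
  left; apply/pcard_leP/injfunPex; exists (fun a => xget point [set b | S (a, b)]).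
    by move=> a /Adom Sa; have [] := SAB _ (xgetPex point Sa).
  move=> a a' /set_mem/Adom Sa /set_mem/Adom Sa' eqf.
  exact/(Sinj _ _ (xgetPex point Sa) (xgetPex point Sa')).
have [Bdom|/existsNP[b /not_implyP[Bb /forallNP Sb]]] :=
    pselect (forall b, B b -> exists a, S (a, b)).
  right; apply/pcard_leP/injfunPex; exists (fun b => xget point [set a | S (a, b)]).
    by move=> b /Bdom Sb; have [] := SAB _ (xgetPex point Sb).
  move=> b b' /set_mem/Bdom Sb /set_mem/Bdom Sb' eqf.
  exact/(Sinj _ _ (xgetPex point Sb) (xgetPex point Sb')).
exfalso; apply: (Smax (S `|` [set (a, b)])); first split.
- exact: subsetUl.
- by move=> /(_ (a, b) (or_intror erefl))/Sa.
- split=> [z [/SAB//|->//]|[x y] [x' y'] [Sz|[-> ->]] [Sw|[-> ->]]//=].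
  + exact: (Sinj _ _ Sz Sw).
  + by split=> e; [have := Sa y; rewrite -e|have := Sb x; rewrite -e].
  + by split=> e; [have := Sa y'; rewrite e|have := Sb x'; rewrite e].
Qed.

(** Two distinct points [a] and [b] of [D] serve as tags: points of [D] are paired with [a], the
    images under [k] of the remaining points with [b], and injectivity of [p] keeps the two kinds
    apart. *)
Lemma disjoint_union_inj (T : pointedType) (D X : set T) (p : T * T -> T) (k : T -> T) :
  infinite_set D -> set_fun (D `*` D) D p -> set_inj (D `*` D) p ->
  set_fun X D k -> set_inj X k ->
  exists2 e : T -> T, set_fun (D `|` X) D e & set_inj (D `|` X) e.
Proof.
move=> Dinf pD pinj kD kinj.
have [a Da] := infinite_setN0 Dinf.
have [b [Db /eqP ba]] := infinite_setN0 (infinite_setD Dinf (finite_set1 a)).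
exists (fun x => if `[< D x >] then p (x, a) else p (k x, b)).
  by move=> x; case: asboolP => [Dx _|nDx [//|Xx]]; apply: pD; split=> //=; exact: kD.
move=> x y /set_mem xE /set_mem yE; case: asboolP => Dx; case: asboolP => Dy.
- by move=> /pinj; rewrite !inE => /(_ (conj Dx Da) (conj Dy Da)) -[].
- case: yE => // /kD ky; move=> /pinj; rewrite !inE.
  move=> /(_ (conj Dx Da) (conj ky Db)) -[_ ab].
  by rewrite ab eqxx in ba.
- case: xE => // /kD kx; move=> /pinj; rewrite !inE.
  move=> /(_ (conj kx Db) (conj Dy Da)) -[_ ab].
  by rewrite ab eqxx in ba.
- case: xE => // Xx; case: yE => // Xy.
  move=> /pinj; rewrite !inE => /(_ (conj (kD _ Xx) Db) (conj (kD _ Xy) Db)) -[] /kinj.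
  by apply; exact: mem_set.
Qed.

(* Zorn's lemma applied to graphs of injections D x D -> D with D infinite: at a
   maximal one, D cannot inject into its complement. *)
Lemma infinite_prod_inj (T : Type) : infinite_set [set: T] ->
  exists p : T * T -> T, injective p.
Proof.
elim/Ppointed: T => T Tinf; first by exists fst => -[x]; have := T x.
(* When [S] satisfies [P], every pair from [dom S] has a value, so the diagonal already recovers the
   set on which [S] is a binary operation. *)
pose dom (S : set ((T * T) * T)) := [set x | exists c, S ((x, x), c)].
(* Infinitude is asked only of nonempty [S], so that the union of the empty chain satisfies [P]. *)
pose P (S : set ((T * T) * T)) :=
  [/\ forall u c, S (u, c) -> [/\ dom S u.1, dom S u.2 & dom S c],
      forall a b, dom S a -> dom S b -> exists c, S ((a, b), c),
      forall z w, S z -> S w -> (z.1 = w.1 <-> z.2 = w.2)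
    & S !=set0 -> infinite_set (dom S)].
have domS S S' : S `<=` S' -> dom S `<=` dom S'.
  by move=> SS' x [c /SS' Sc]; exists c.
have [|S [[Scl Stot Sinj Sinf] Smax]] := @Zorn_bigcup _ P.
  move=> F FP Ftot; split.
  - move=> u c [S FS Su]; have [S1 _ _ _] := FP _ FS.
    have sub := @bigcup_sup _ _ S F id FS.
    by have [? ? ?] := S1 _ _ Su; split; exact: domS sub _ _.
  - move=> a b [c [S FS Sa]] [d [S' FS' Sb]].
    have [SS'|S'S] := Ftot _ _ FS FS'.
      have [_ S2 _ _] := FP _ FS'; have [||e Se] := S2 a b; [|by exists d|].
        by exists c; exact: SS'.
      by exists e; exists S'.
    have [_ S2 _ _] := FP _ FS; have [||e Se] := S2 a b; [by exists c| |].
      by exists d; exact: S'S.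
    by exists e; exists S.
  - move=> z w [S FS Sz] [S' FS' S'w].
    have [_ _ S3 _] := FP _ FS; have [_ _ S3' _] := FP _ FS'.
    by have [SS'|S'S] := Ftot _ _ FS FS';
      [apply: S3' => //; exact: SS'|apply: S3 => //; exact: S'S].
  - move=> [z [S FS Sz]]; have [_ _ _ S4] := FP _ FS.
    apply: (sub_infinite_set (domS _ _ (@bigcup_sup _ _ S F id FS))).
    by apply: S4; exists z.
pose D := dom S.
have [S0|SN0] := pselect (S !=set0); last first.
  exfalso.
  (* The empty graph is not maximal: a copy of the natural numbers in [T], with the pairing given by
     [pickle], lies strictly above it. *)
  have /infiniteP/pcard_leP[g] := Tinf.
  pose q (m n : nat) := g (choice.pickle (m, n)).
  pose S' := [set z | exists m n, z = ((g m, g n), q m n)].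
  have ginj : injective g by move=> m n; apply: (@inj _ _ _ g); rewrite inE.
  have domg m : dom S' (g m) by exists (q m m), m, m.
  apply: (Smax S'); first split.
  - by move=> z Sz; exfalso; apply: SN0; exists z.
  - move=> S'S; apply: SN0; exists ((g 0, g 0), q 0 0)%N; apply: S'S.
    by exists 0%N, 0%N.
  split.
  - by move=> u c [m [n [-> ->]]]; split; exact: domg.
  - by move=> a b [c [m [n [-> _ _]]]] [d [m' [n' [-> _ _]]]]; exists (q m m'), m, m'.
  - move=> z w [m [n ->]] [m' [n' ->]] /=; split=> [[/ginj -> /ginj ->]//|/ginj].
    by move/(pcan_inj choice.pickleK) => [-> ->].
  - move=> _; apply/infiniteP/pcard_leP/injfunPex; exists g => [m _|m n _ _ /ginj//].
    exact: domg.
have Dinf : infinite_set D := Sinf S0.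
pose p (z : T * T) := xget point [set c | S (z, c)].
have Sp z : (D `*` D) z -> S (z, p z).
  case: z => a b [/= Da Db]; apply: (@xgetPex _ point [set c | S ((a, b), c)]).
  exact: Stot.
have pD : set_fun (D `*` D) D p by move=> z /Sp/Scl[].
have pinj : set_inj (D `*` D) p.
  by move=> z w /set_mem/Sp Sz /set_mem/Sp Sw e; apply/(Sinj _ _ Sz Sw).
have [/pcard_leP/injfunPex[g gND ginj]|/pcard_leP/injfunPex[k kD kinj]] :=
    card_le_total D (~` D); last first.
  (* Here the complement of [D] injects into [D], hence so does all of [T], and [p] finishes the
     proof. *)
  have [e eD einj] := disjoint_union_inj Dinf pD pinj kD kinj.
  rewrite setUv in eD einj.
  have De x : D (e x) by exact: eD.
  exists (fun z => p (e z.1, e z.2)) => -[x y] [x' y'] /=.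
  move=> /pinj; rewrite !inE => /(_ (conj (De _) (De _)) (conj (De _) (De _))) -[].
  by move=> /einj -> ; rewrite ?inE// => /einj ->; rewrite ?inE.
(* Now [g] places a copy [X] of [D] in the complement. On pairs from [E] outside the square of [D]
   the injection [q] takes values in [X], where [p] takes none, so [S'] contradicts maximality. *)
exfalso.
pose X := g @` D.
have [k [kD kinj]] : exists k : T -> T, set_fun X D k /\ set_inj X k.
  pose k x := xget point [set d | D d /\ g d = x].
  have kP x : X x -> D (k x) /\ g (k x) = x.
    by move=> [d Dd gd]; apply: (@xgetPex _ point [set d | D d /\ g d = x]); exists d.
  exists k; split=> [x /kP[]//|x y /set_mem/kP[_ kx] /set_mem/kP[_ ky] kxy].
  by rewrite -kx -ky kxy.
have [e eD einj] := disjoint_union_inj Dinf pD pinj kD kinj.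
pose E := D `|` X.
pose q z := g (p (e z.1, e z.2)).
have pe z : (E `*` E) z -> D (p (e z.1, e z.2)).
  by move=> [? ?]; apply: pD; split; exact: eD.
have qX z : (E `*` E) z -> X (q z) by move=> /pe ?; exists (p (e z.1, e z.2)).
have qinj : set_inj (E `*` E) q.
  move=> [x y] [x' y'] /set_mem zE /set_mem wE /ginj; rewrite !inE.
  move=> /(_ (pe _ zE) (pe _ wE)) /pinj; rewrite !inE /=.
  case: zE => [xE yE]; case: wE => [xE' yE'].
  move=> /(_ (conj (eD _ xE) (eD _ yE)) (conj (eD _ xE') (eD _ yE'))) [].
  by move=> /einj -> ; rewrite ?inE// => /einj ->; rewrite ?inE.
have XND x : X x -> ~ D x by move=> [d Dd <-]; exact: gND.
pose S' := S `|` [set z | [/\ (E `*` E) z.1, ~ (D `*` D) z.1 & z.2 = q z.1]].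
have SD u c : S (u, c) -> (D `*` D) u /\ D c by move=> /Scl[].
have domE : dom S' = E.
  apply/seteqP; split=> x; first by case=> c [/SD[[? _] _]|[[]]//]; left.
  move=> Ex; have [Dx|nDx] := pselect (D x).
    by exists (p (x, x)); left; exact: Sp.
  by exists (q (x, x)); right; split => // -[].
apply: (Smax S'); first split.
- exact: subsetUl.
- have [d Dd] := infinite_setN0 Dinf.
  have Xg : X (g d) by exists d.
  move=> /(_ ((g d, g d), q (g d, g d))) S'S.
  have /SD[[/= /(XND _ Xg)]] // : S ((g d, g d), q (g d, g d)).
  by apply: S'S; right; split=> /=; [split; right|move=> [/(XND _ Xg)]|].
rewrite /P domE; split.
- move=> u c [/SD[[? ?] ?]|[/= uE _ ->]]; first by split; left.
  by split; [case: uE..|right; exact: qX].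
- move=> a b Ea Eb; have [Dab|nDab] := pselect ((D `*` D) (a, b)).
    by exists (p (a, b)); left; exact: Sp.
  by exists (q (a, b)); right.
- move=> [u c] [v d] [Su|[/= uE nu ->]] [Sv|[/= vE nv ->]] /=.
  + exact: (Sinj _ _ Su Sv).
  + have [uD cD] := SD _ _ Su; split=> e'; first by rewrite e' in uD.
    by case: (XND _ (qX _ vE)); rewrite -e'.
  + have [vD dD] := SD _ _ Sv; split=> e'; first by rewrite -e' in vD.
    by case: (XND _ (qX _ uE)); rewrite e'.
  + by split=> [->//|/qinj]; apply; exact: mem_set.
- by move=> _; apply: sub_infinite_set Dinf; left.
Qed.

(** A list is coded by its iterated pairing together with its length; the length tells the decoding
    where the list ends. *)
Lemma infinite_seq_nat_card_le (T : Type) : infinite_set [set: T] ->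
  ([set: seq T * nat] #<= [set: T])%card.
Proof.
move=> Tinf; have [p pinj] := infinite_prod_inj Tinf.
elim/Ppointed: T => T in p pinj Tinf *; first by case: Tinf; rewrite emptyE.
have /infiniteP/pcard_leP[g] := Tinf.
have ginj : injective g by move=> m n; apply: (@inj _ _ _ g); rewrite inE.
apply/pcard_leP/injfunPex.
exists (fun z => p (p (g (size z.1), foldr (fun x y => p (x, y)) point z.1),
  g z.2)) => //.
move=> [s n] [t m] _ _ /= /pinj[/pinj[/ginj]] + + /ginj ->.
elim: s t => [|x s IH] [|y t]//= [st] /pinj[-> /IH H].
by have [->] := H st.
Qed.

(** * Homomorphisms between symmetric groups with controlled fixed points *)

Lemma morph_multiplicative (G H : groupType) (h : G -> H) :
  {morph h : x y / (x * y)%g} -> exists f : {multiplicative G -> H}, f =1 h.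
Proof.
move=> hM.
pose hMm := isMultiplicative.Build G H h hM.
pose f : {multiplicative G -> H} := HB.pack h hMm.
by exists f.
Qed.

Lemma multiplicative1 (G H : groupType) (f : {multiplicative G -> H}) :
  f 1%g = 1%g.
Proof. by apply: (@mulgI _ (f 1%g)); rewrite -gmulfM !mulg1. Qed.

Lemma multiplicativeV (G H : groupType) (f : {multiplicative G -> H}) :
  {morph f : x / x^-1%g}.
Proof.
by move=> x; apply: (@mulgI _ (f x)); rewrite -gmulfM !mulgV multiplicative1.
Qed.

Section PermConj.
Variables (T U : finType) (f : T -> U) (g : U -> T).
Hypotheses (fK : cancel f g) (gK : cancel g f).

Lemma conj_perm_inj (s : {perm T}) : injective (f \o s \o g).
Proof. exact: inj_comp (inj_comp (can_inj fK) perm_inj) (can_inj gK). Qed.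

Definition conj_perm s := perm (@conj_perm_inj s).

Lemma conj_permM : {morph conj_perm : s t / (s * t)%g}.
Proof. by move=> s t; apply/permP => x; rewrite permM !permE /= permM fK. Qed.

Lemma card_fix_conj_perm s :
  #|[pred x | conj_perm s x == x]| = #|[pred x | s x == x]|.
Proof.
rewrite -[RHS](fintype.card_image (can_inj fK)); apply: eq_card => x.
rewrite inE permE /=; apply/eqP/fintype.imageP => [sx|[y + ->]].
  by exists (g x); rewrite ?gK// inE -[s _]fK sx.
by rewrite inE fK => /eqP ->.
Qed.

End PermConj.

Lemma perm_card_ord (T : finType) n : #|T| = n ->
  exists h : {perm T} -> 'S_n, {morph h : s t / (s * t)%g} /\
    forall s, nfix (h s) = #|[pred x | s x == x]|.
Proof.
move=> <-; exists (conj_perm (@enum_rankK T) (@enum_valK T)); split.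
  exact: conj_permM.
exact: card_fix_conj_perm.
Qed.

Section PermPower.
Variables (T : finType) (k : nat).

Lemma ffun_perm_inj (s : {perm T}) :
  injective (fun x : {ffun 'I_k -> T} => [ffun j => s (x j)]).
Proof.
move=> x y /ffunP sxy; apply/ffunP => j.
by have := sxy j; rewrite !ffunE => /perm_inj.
Qed.

Definition ffun_perm s := perm (@ffun_perm_inj s).

Lemma ffun_permM : {morph ffun_perm : s t / (s * t)%g}.
Proof.
move=> s t; apply/permP => x; rewrite permM !permE; apply/ffunP => j.
by rewrite !ffunE permM.
Qed.

(** A tuple is fixed by the diagonal action exactly when all its entries are fixed. *)
Lemma card_fix_ffun_perm s :
  #|[pred x | ffun_perm s x == x]| = (#|[pred x | s x == x]| ^ k)%N.
Proof.
rewrite -[in RHS](card_ord k) -card_ffun_on; apply: eq_card => x.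
rewrite inE permE; apply/eqP/ffun_onP => [/ffunP sx j|sx].
  by have := sx j; rewrite ffunE inE => ->.
by apply/ffunP => j; rewrite ffunE; apply/eqP; have := sx j; rewrite inE.
Qed.

End PermPower.

Section PermBlowUp.
Variables (T U : finType).

Lemma prod_perm_inj (s : {perm T}) : injective (fun x : T * U => (s x.1, x.2)).
Proof. by move=> [x i] [y j] [/perm_inj -> ->]. Qed.

Definition prod_perm s := perm (@prod_perm_inj s).

Lemma prod_permM : {morph prod_perm : s t / (s * t)%g}.
Proof. by move=> s t; apply/permP => x; rewrite permM !permE. Qed.

Lemma card_fix_prod_perm s :
  #|[pred x | prod_perm s x == x]| = (#|[pred x | s x == x]| * #|U|)%N.
Proof.
rewrite -cardX; apply: eq_card => -[x i].
by rewrite !inE permE /= -pair_eqE /= eqxx !andbT.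
Qed.

End PermBlowUp.

Lemma sym_power d k : exists h : {multiplicative 'S_d -> 'S_(d ^ k)},
  forall s, nfix (h s) = (nfix s ^ k)%N.
Proof.
have [|h [hM hfix]] := @perm_card_ord {ffun 'I_k -> 'I_d} (d ^ k).
  by rewrite card_ffun !card_ord.
have [|f fE] := @morph_multiplicative 'S_d 'S_(d ^ k) (h \o @ffun_perm _ k).
  by move=> s t; rewrite /= ffun_permM hM.
by exists f => s; rewrite fE /= hfix card_fix_ffun_perm.
Qed.

(** Acting on [c] disjoint copies multiplies the degree by [c] and, for positive [c], preserves the
    ratio of fixed points. *)
Lemma sym_blow_up d c : exists h : {multiplicative 'S_d -> 'S_(d * c)},
  forall s, nfix (h s) = (nfix s * c)%N.
Proof.
have [|h [hM hfix]] := @perm_card_ord ('I_d * 'I_c)%type (d * c).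
  by rewrite card_prod !card_ord.
have [|f fE] := @morph_multiplicative 'S_d 'S_(d * c) (h \o @prod_perm _ 'I_c).
  by move=> s t; rewrite /= prod_permM hM.
by exists f => s; rewrite fE /= hfix card_fix_prod_perm card_ord.
Qed.

(** * Ultraproducts of symmetric groups are sofic *)

Lemma near_finite_set (I : choiceType) (T : Type) (F : set_system T) (A : set I)
    (P : I -> T -> Prop) : Filter F -> finite_set A ->
  (forall a, A a -> \forall t \near F, P a t) ->
  \forall t \near F, forall a, A a -> P a t.
Proof.
move=> FF Afin AP.
have := @filter_bigI T I (fset_set A) (fun a => [set t | P a t]) F FF.
by rewrite fset_setK//; apply=> a; rewrite in_fset_set// inE; exact: AP.
Qed.

Section UltraproductSofic.
Variables (R : realType) (I : Type) (omega : set_system I).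
Variables (Uomega : UltraFilter omega) (tau : I -> nat).
Variable tau_oo : tau @ omega --> \oo.
Local Notation H := (sym_ultraprod R Uomega tau_oo).
Local Notation N := (fix1_subgroup R Uomega tau_oo).

(** The quotient compares [p] and [q] through [q^-1 * p], a conjugate of [p * q^-1]; the latter is
    the shape used in [sofic]. *)
Lemma pi_sym_ultraprod_eq (p q : sym_prod tau) :
  \pi_(group_quot N)%qT p = \pi_(group_quot N)%qT q <->
  fixlim R omega (p * q^-1)%g = 1.
Proof.
have -> : fixlim R omega (p * q^-1)%g = fixlim R omega (q^-1 * p)%g.
  by rewrite -(fixlim_conj R omega _ q) conjgE mulgVK.
have <- : (coset_rel N q p : Prop) <-> fixlim R omega (q^-1 * p)%g = 1.
  by rewrite /coset_rel inE; split=> /eqP.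
by split=> [/esym/coset_eqP//|/coset_eqP/esym].
Qed.

Lemma pi_sym_ultraprodM (p q : sym_prod tau) :
  (\pi_(group_quot N)%qT (p * q)%g : H) =
  ((\pi_(group_quot N)%qT p : H) * (\pi_(group_quot N)%qT q : H))%g.
Proof. by rewrite -[LHS]quot_mulE. Qed.

Lemma sym_ultraprod_lift : exists lift : H -> sym_prod tau,
  [/\ lift 1%g = 1%g,
      forall e f, fixlim R omega (lift e * lift f * (lift (e * f)%g)^-1)%g = 1
    & forall e, e <> 1%g -> fixlim R omega (lift e) < 1].
Proof.
(* The representative chosen by [repr] for the unit is only congruent to the identity, while [sofic]
   demands [phi 1 = 1] exactly. *)
pose lift (x : H) : sym_prod tau := if x == 1%g then 1%g else @repr _ (group_quot N) x.
have liftK x : \pi_(group_quot N)%qT (lift x) = x.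
  by rewrite /lift; case: eqP => [->//|_]; rewrite reprK.
exists lift; split=> [|e f|e e1].
- by rewrite /lift eqxx.
- by apply/pi_sym_ultraprod_eq; rewrite liftK -[LHS]quot_mulE !liftK.
- rewrite lt_neqAle; apply/andP; split.
    apply/eqP => h; apply: e1; rewrite -(liftK e); apply/pi_sym_ultraprod_eq.
    by rewrite invg1 mulg1.
  apply: limr_le; first exact: is_cvg_fix_ratio.
  by apply: nearW => i; exact: fix_ratio_le1.
Qed.

Lemma fixlim_ge0 (p : sym_prod tau) : 0 <= fixlim R omega p.
Proof.
apply: limr_ge; first exact: is_cvg_fix_ratio.
by apply: nearW => i; exact: fix_ratio_ge0.
Qed.

(* Since fixlim (lift e) < 1 need not be small, the lifted permutations act
   diagonally on k-tuples, which raises the ratio of fixed points to the power k. *)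
Lemma sym_ultraprod_sofic : sofic R H.
Proof.
have [lift [lift1 liftM lift_lt1]] := sym_ultraprod_lift.
move=> eps F /andP[eps0 eps1] Ffin.
(* The exponent is fixed before the index: powers of the finitely many limits below 1 tend to 0. For
   this fixed [k] the power map is continuous, so strict bounds on the limits pass to almost all
   indices. *)
have knear : \forall k \near \oo, forall e, F e -> e <> 1%g ->
    fixlim R omega (lift e) ^+ k < eps.
  apply: near_finite_set => // e _.
  have [->|/eqP e1] := eqVneq e 1%g; first exact: nearW.
  have : fixlim R omega (lift e) ^+ k @[k --> \oo] --> 0.
    by apply: cvg_expr; rewrite ger0_norm ?fixlim_ge0// lift_lt1.
  by move=> /cvgr_lt/(_ _ eps0); apply: filterS => k ? _.
have [k Fk] := filter_ex knear.
have cvgk (p : sym_prod tau) :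
    fix_ratio R p i ^+ k @[i --> omega] --> fixlim R omega p ^+ k.
  exact: continuous_cvg _ (@exprn_continuous R k _) (@fixlimP R I omega Uomega tau p).
have Mnear : \forall i \near omega, forall u, (F `*` F) u -> 1 - eps <
    fix_ratio R (lift u.1 * lift u.2 * (lift (u.1 * u.2)%g)^-1)%g i ^+ k.
  apply: near_finite_set => [|u _]; first exact: finite_setX.
  by apply: (cvgr_gt _ (cvgk _)); rewrite liftM expr1n; lra.
have enear : \forall i \near omega, forall e, F e -> e <> 1%g ->
    fix_ratio R (lift e) i ^+ k < eps.
  apply: near_finite_set => // e Fe.
  have [->|/eqP e1] := eqVneq e 1%g; first exact: nearW.
  have lt_eps : \forall i \near omega, fix_ratio R (lift e) i ^+ k < eps.
    exact: (cvgr_lt _ (cvgk (lift e)) _ (Fk e Fe e1)).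
  exact: (filterS (fun j lt_j _ => lt_j) lt_eps).
have [i [ti [Mi ei]]] :=
  filter_ex (filterI (tau_gt0 tau_oo) (filterI Mnear enear)).
have [h hfix] := sym_power (tau i) k.
have ratioE (p : sym_prod tau) :
    fix_ratio R p i ^+ k = (nfix (h (p i)))%:R / (tau i ^ k)%N%:R.
  by rewrite /fix_ratio hfix exprMn exprVn !natrX.
have tk0 : 0 < ((tau i ^ k)%N%:R : R) by rewrite ltr0n expn_gt0 ti.
exists (tau i ^ k)%N, (fun e => h (lift e i)); split.
- by rewrite expn_gt0 ti.
- move=> e f Fe Ff; have /ltW := Mi (e, f) (conj Fe Ff).
  rewrite ratioE ler_pdivlMr//=.
  (* Products and inverses in [sym_prod] are componentwise by definition. *)
  rewrite [X in h X](_ : _ = lift e i * lift f i * (lift (e * f) i)^-1)%g//.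
  by rewrite !gmulfM multiplicativeV.
- by rewrite lift1 [h _]multiplicative1.
- by move=> e Fe e1; have /ltW := ei _ Fe e1; rewrite ratioE ler_pdivrMr.
Qed.

End UltraproductSofic.

(** * Subgroups of sofic groups, and embedding sofic groups into ultraproducts *)

Lemma sofic_inj (R : realType) (G H : groupType) (f : {multiplicative G -> H}) :
  injective f -> sofic R H -> sofic R G.
Proof.
move=> finj sH eps F eps01 Ffin.
have [n [phi [n1 phiM phi1 phi_fix]]] := sH eps (f @` F) eps01 (finite_image f Ffin).
exists n, (phi \o f); split=> //=.
- by move=> e e' Fe Fe'; rewrite gmulfM; apply: phiM; [exists e|exists e'].
- by rewrite multiplicative1.
- move=> e Fe e1; apply: phi_fix; first by exists e.
  by rewrite -(multiplicative1 f) => /finj.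
Qed.

Lemma card_seq_nat_index (T : Type) : index_card_le (seq T * nat) T.
Proof.
have [Tfin|/infinite_seq_nat_card_le] := pselect (finite_set [set: T]); last by left.
right; split=> //; have [T' ->] := Pcountable (finite_set_countable Tfin).
exact: countableP.
Qed.

(* Replacing 'S_m by 'S_(m * n.+1) forces the degree to exceed n, which soficity
   alone does not do when G is finite. *)
Lemma sofic_approx (R : realType) (G : groupType) (s : seq G) (n : nat) :
  sofic R G -> exists m (phi : G -> 'S_m),
  [/\ (n < m)%N,
      {in s &, forall e f, (1 - n.+2%:R^-1) * m%:R <=
        (nfix (phi e * phi f * (phi (e * f)%g)^-1)%g)%:R :> R}
    & {in s, forall e, e <> 1%g -> (nfix (phi e))%:R <= n.+2%:R^-1 * m%:R :> R}].
Proof.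
(* The shift by 2 keeps the accuracy strictly below 1 even for [n = 0]. *)
move=> /(_ n.+2%:R^-1 [set` s])[].
- by rewrite invr_gt0 ltr0n/= invf_lt1 ?ltr0n// ltr1n.
- exact: finite_seq.
move=> m [phi [m1 phiM _ phi_fix]].
have [h hfix] := sym_blow_up m n.+1.
exists (m * n.+1)%N, (h \o phi); split=> /=.
- by rewrite leq_pmull.
- move=> e f es fs; rewrite -multiplicativeV -!gmulfM hfix !natrM mulrA.
  by rewrite ler_wpM2r ?ler0n//; exact: phiM.
- by move=> e es e1; rewrite hfix !natrM mulrA ler_wpM2r ?ler0n//; exact: phi_fix.
Qed.

Lemma sofic_ultraprod_inj (R : realType) (G : groupType) : sofic R G ->
  exists (I : Type) (omega : set_system I) (Uomega : UltraFilter omega)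
         (tau : I -> nat) (tau_oo : tau @ omega --> \oo)
         (f : {multiplicative G -> sym_ultraprod R Uomega tau_oo}),
    index_card_le I G /\ injective f.
Proof.
move=> sG; pose I : Type := (seq G * nat)%type.
(* Degree and map form one dependent pair, so that a single use of choice selects both. *)
pose approx (i : I) (x : {m : nat & G -> 'S_m}) := let phi := projT2 x in
  [/\ (i.2 < projT1 x)%N,
      {in i.1 &, forall e f, (1 - i.2.+2%:R^-1) * (projT1 x)%:R <=
        (nfix (phi e * phi f * (phi (e * f)%g)^-1)%g)%:R :> R}
    & {in i.1, forall e, e <> 1%g ->
        (nfix (phi e))%:R <= i.2.+2%:R^-1 * (projT1 x)%:R :> R}].
have /choice[x xP] : forall i, exists x, approx i x.
  move=> [s n]; have [m [phi ?]] := sofic_approx s n sG.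
  by exists (existT _ m phi).
pose tau i := projT1 (x i).
pose above (j : I) := [set i : I | {subset j.1 <= i.1} /\ (j.2 <= i.2)%N].
have aboveF : ProperFilter (filter_from setT above).
  apply: filter_from_proper; last by move=> j _; exists j; split.
  apply: filter_fromT_filter; first by exists ([::], 0%N).
  (* Concatenation and maximum give an upper bound of two indices, so the cones form a filter
     base. *)
  move=> [s m] [t n]; exists (s ++ t, maxn m n) => i /= [si].
  rewrite geq_max => /andP[mi ni].
  by split; split=> // e es; apply: si; rewrite mem_cat es ?orbT.
have [omega [Uomega omegaF]] := ultraFilterLemma aboveF.
have omega_above j : omega (above j) by apply: omegaF; exists j.
have tau_oo : tau @ omega --> \oo.
  apply/cvgnyPge => n; apply: filterS (omega_above ([::], n)) => i [_ /= ni].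
  by have [/ltnW/(leq_trans ni)] := xP i.
pose phi e : sym_prod tau := fun i => projT2 (x i) e.
have phiM e f : fixlim R omega (phi (e * f) * (phi e * phi f)^-1)%g = 1.
  (* Inversion turns the quotient of the two products into the expression bounded in [approx]. *)
  rewrite -fixlim_inv invgM invgK.
  apply: cvg_lim => //.
  apply: (@squeeze_cvgr _ _ _ _ (fun i => 1 - i.2.+2%:R^-1) (cst 1)).
  - apply: filterS (omega_above ([:: e; f], 0%N)) => i [/= si _].
    have [ti phiM _] := xP i; rewrite fix_ratio_le1 andbT /fix_ratio.
    rewrite ler_pdivlMr ?ltr0n ?(leq_ltn_trans _ ti)//.
    by apply: phiM; apply: si; rewrite !inE eqxx ?orbT.
  - rewrite -[X in _ --> X]subr0; apply: cvgB; first exact: cvg_cst.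
    (* The harmonic sequence at [n] is the inverse of [n.+1], hence its evaluation at [i.2.+1]. *)
    apply: (@cvg_comp _ _ _ (fun i : I => i.2.+1) (fun n => n.+1%:R^-1) _ \oo).
      apply/cvgnyPge => n; apply: filterS (omega_above ([::], n)) => i [_ /= ni].
      exact: leqW.
    exact: cvg_harmonic.
  - exact: cvg_cst.
pose f e : sym_ultraprod R Uomega tau_oo := \pi_(group_quot _)%qT (phi e).
have [|g gE] := @morph_multiplicative _ _ f.
  by move=> e e'; rewrite /f -pi_sym_ultraprodM; apply/pi_sym_ultraprod_eq/phiM.
exists I, omega, Uomega, tau, tau_oo, g; split; first exact: card_seq_nat_index.
have g_ker e : g e = 1%g -> e = 1%g.
  rewrite gE => /pi_sym_ultraprod_eq; rewrite invg1 mulg1 => phie1.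
  (* On the cone above [([:: e], 0)] the accuracy is at most one half, which bounds the limit of the
     ratios for a nontrivial [e] away from 1. *)
  apply: contrapT => e1; suff : fixlim R omega (phi e) <= 2^-1.
    by rewrite phie1; lra.
  apply: limr_le; first exact: is_cvg_fix_ratio.
  apply: filterS (omega_above ([:: e], 0%N)) => i [/= si _].
  have [ti _ /(_ e)] := xP i; rewrite si ?inE// => /(_ isT e1) phi_fix.
  rewrite /fix_ratio ler_pdivrMr ?ltr0n ?(leq_ltn_trans _ ti)//.
  apply: le_trans phi_fix _; rewrite ler_wpM2r ?ler0n//.
  by rewrite lef_pV2 ?posrE ?ltr0n// ler_nat.
move=> a b gab; apply/divg1_eq/g_ker.
by rewrite gmulfM multiplicativeV gab mulgV.
Qed.

Theorem theorem1 (R : realType) :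
  (forall G : groupType,
     sofic R G <->
     exists (I : Type) (omega : set_system I) (Uomega : UltraFilter omega)
            (tau : I -> nat) (tau_oo : (tau @ omega --> \oo)%classic)
            (f : {multiplicative G -> sym_ultraprod R Uomega tau_oo}),
       index_card_le I G /\ injective f) /\
  (forall (I : Type) (omega : set_system I) (Uomega : UltraFilter omega)
          (tau : I -> nat) (tau_oo : (tau @ omega --> \oo)%classic),
     sofic R (sym_ultraprod R Uomega tau_oo)).
Proof.
split=> [G|I omega Uomega tau tau_oo]; last exact: sym_ultraprod_sofic.
split=> [|[I [omega [Uomega [tau [tau_oo [f [_ finj]]]]]]]].
  exact: sofic_ultraprod_inj.
by apply: sofic_inj finj _; exact: sym_ultraprod_sofic.
Qed.
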